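(* Let $q$ be an odd prime power, let $\beta,a,b,c\in\mathbb F_{q^2}$ and $d\in\mathbb F_{q^2}\setminus\mathbb F_q$, and suppose $\beta\neq1$ and $\beta^{q+1}=1$. Then \[\frac{x^{q+1}+\beta x^2+ax^q+bx+c}{x^q+x+d}\] is not a permutation rational function of $\mathbb F_{q^2}$.
   Context: A rational function $f$ over a finite field $\mathbb F_Q$ is written uniquely as $f=e\,\frac{g}{h}$ with $g,h$ relatively prime monic polynomials over $\mathbb F_Q$ and $e\in\mathbb F_Q^*$. It defines a map on $\mathbb F_Q\cup\{\infty\}$: for $s\in\mathbb F_Q$, $f(s)=e\,g(s)/h(s)$ if $h(s)\neq0$ and $f(s)=\infty$ if $h(s)=0$; moreover $f(\infty)=\infty$ if $\deg g>\deg h$, $f(\infty)=e$ if $\deg g=\deg h$, and $f(\infty)=0$ if $\deg g<\deg h$. If this map is a permutation of $\mathbb F_Q\cup\{\infty\}$, then $f$ is called a permutation rational function of $\mathbb F_Q$. Here $Q=q^2$. (Since $d\notin\mathbb F_q$, the denominator $x^q+x+d$ has no zero in $\mathbb F_{q^2}$.) *)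

(* Defs.v *)
From mathcomp Require Import all_boot all_algebra.

Set Implicit Arguments.
Unset Strict Implicit.
Unset Printing Implicit Defensive.

Import GRing.Theory.
Local Open Scope ring_scope.

Notation "x %:F" := (@FracField.tofrac _ x) : ring_scope.

Definition reduced_form (F : fieldType) (f : {fraction {poly F}})
    (e : F) (g h : {poly F}) : Prop :=
  [/\ e != 0, g \is monic, h \is monic, coprimep g h
    & f = (e%:P)%:F * (g%:F / h%:F)].

(* [None] stands for the point at infinity; since g and h are nonzero,
   comparing sizes is comparing degrees. *)
Definition projective_map (F : fieldType) (e : F) (g h : {poly F})
    (s : option F) : option F :=
  match s with
  | Some x => if h.[x] == 0 then None else Some (e * g.[x] / h.[x])
  | None => if (size h < size g)%N then None
            else if size g == size h then Some e else Some 0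
  end.

(* The triple (e, g, h) exists for f != 0 and is unique: see
   [reduced_form_exists] and [reduced_form_unique] below.  The rational
   function 0 has no such form, and is not a permutation. *)
Definition permutation_rational_function (F : finFieldType)
    (f : {fraction {poly F}}) : Prop :=
  exists e g h, reduced_form f e g h /\ bijective (projective_map e g h).

Lemma reduced_form_exists (F : fieldType) (f : {fraction {poly F}}) :
  f != 0 -> exists e g h, reduced_form f e g h.
Proof.
have [n [d [d0 ->]]] : exists n d : {poly F}, d != 0 /\ f = n%:F / d%:F.
  elim/quotW: f => r; have r0 := denom_ratioP r.
  exists \n_r, \d_r; split=> //; apply: (canRL (mulfK _)); first by rewrite tofrac_eq0.
  apply/eqP; rewrite !piE /FracField.equivf /FracField.mulf.
  by rewrite !numden_Ratio ?mulf_neq0 ?oner_eq0 //= !mulr1 mulrC.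
rewrite mulf_eq0 invr_eq0 !tofrac_eq0 negb_or d0 andbT => n0.
pose G := gcdp n d; pose g := n %/ G; pose h := d %/ G.
have nE : n = g * G by rewrite divpK ?dvdp_gcdl.
have dE : d = h * G by rewrite divpK ?dvdp_gcdr.
have G0 : G != 0 by rewrite gcdp_eq0 negb_and n0.
have g0 : g != 0 by apply: contraNneq n0 => g0; rewrite nE g0 mul0r.
have h0 : h != 0 by apply: contraNneq d0 => h0; rewrite dE h0 mul0r.
have lg : lead_coef g != 0 by rewrite lead_coef_eq0.
have lh : lead_coef h != 0 by rewrite lead_coef_eq0.
exists (lead_coef g / lead_coef h), ((lead_coef g)^-1 *: g),
  ((lead_coef h)^-1 *: h); split.
- by rewrite mulf_neq0 ?invr_eq0.
- by rewrite monicE lead_coefZ mulVf.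
- by rewrite monicE lead_coefZ mulVf.
- by rewrite coprimepZl ?coprimepZr ?invr_eq0 // coprimep_div_gcd ?n0.
have GF : G%:F != 0 by rewrite tofrac_eq0.
have hF : h%:F != 0 by rewrite tofrac_eq0.
have kF : ((lead_coef h)^-1 *: h)%:F != 0.
  by rewrite tofrac_eq0 scaler_eq0 invr_eq0 negb_or lh.
have dF : d%:F != 0 by rewrite tofrac_eq0.
rewrite mulrA; apply/eqP; rewrite (eqr_div _ _ dF kF).
rewrite -!tofracM tofrac_eq -!mul_polyC {1}nE {1}dE; apply/eqP.
rewrite polyCM; set u := (lead_coef g)%:P; set v := (_^-1)%:P; set w := (_^-1)%:P.
have uw : u * w = 1 by rewrite -polyCM mulfV.
rewrite [X in X * (h * G)]mulrACA uw mul1r.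
by rewrite [LHS]mulrC mulrACA.
Qed.

Lemma reduced_form_unique (F : fieldType) (f : {fraction {poly F}})
    e g h e' g' h' :
  reduced_form f e g h -> reduced_form f e' g' h' ->
  [/\ e = e', g = g' & h = h'].
Proof.
case=> e0 mg mh cgh -> [e'0 mg' mh' cgh'].
have hF : h%:F != 0 by rewrite tofrac_eq0 monic_neq0.
have h'F : h'%:F != 0 by rewrite tofrac_eq0 monic_neq0.
rewrite !mulrA => /eqP; rewrite (eqr_div _ _ hF h'F) -!tofracM tofrac_eq => /eqP E.
have ee : e = e'.
  move: (congr1 lead_coef E).
  by rewrite !lead_coefM !lead_coefC !(monicP _) // !mulr1.
rewrite -{}ee {e' e'0} in E *.
have {}E : g * h' = g' * h.
  by apply: (@mulfI _ e%:P); rewrite ?polyC_eq0 // !mulrA.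
have gg : g = g'.
  apply/eqP; rewrite -eqp_monic //; apply/andP; split.
    by rewrite -(Gauss_dvdpl g' cgh) -E dvdp_mulr.
  by rewrite -(Gauss_dvdpl g cgh') E dvdp_mulr.
split=> //; apply: (mulfI (monic_neq0 mg)).
by rewrite E -gg.
Qed.

(* Main.v *)
Require Import Defs.
From HB Require Import structures.
From mathcomp Require Import all_boot all_algebra.
From mathcomp Require Import finfield.
From mathcomp Require Import zify ring.

Import GRing.Theory.
Local Open Scope ring_scope.

(** Write [J x = x ^+ q], the involution of F whose fixed field is F_q, and let
    N and D be the numerator and the denominator.  Since D has no root in F and
    the degree of N exceeds that of D, the projective map fixes infinity, so a
    permutation rational function would make N / D surjective on F
    ([permutation_rational_function_onto]).

    As beta has norm 1, Hilbert 90 gives a nonzero alpha with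
    [J alpha = beta * alpha].  Then the quadratic part of N factors:
    [alpha * (x * J x + beta * x ^+ 2) = x * L x], where
    [L x = J alpha * x + alpha * J x] is F_q-valued.  Put
    [eps = J alpha - alpha], which is nonzero since beta <> 1.  Writing N in
    terms of [L x] and of D, one gets
    [alpha * eps * N x = alpha * (s0 - L x) * D x + P (L x)]
    with s0 a constant and P a monic quadratic polynomial over F.

    Now let l0 be in F_q and suppose that N / D takes the value
    [(s0 - l0) / eps] at x.  With [l = L x] this says
    [P l = alpha * (l - l0) * D x].  Multiplying by [J alpha] and subtracting
    the conjugate equation eliminates x, because [D x - J (D x) = d - J d]:
    [J alpha * P l - alpha * J (P l) = alpha * J alpha * (d - J d) * (l - l0)].
    As d is not in F_q this can be solved for l0, which becomes a quadratic
    polynomial Q in l with nonzero leading coefficient.  Hence if N / D were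
    surjective, Q would take every value of F_q on F_q, and so be injective
    there.  But in odd characteristic a quadratic polynomial takes equal values
    at two points symmetric about its vertex ([quadratic_not_onto]). *)

(** Over F a denominator without roots stays without roots after reduction to
    lowest terms, and the reduced fraction still sends infinity to infinity, so
    each finite value is taken at a finite point. *)
Lemma permutation_rational_function_onto (F : finFieldType)
    (N D : {poly F}) :
  (size D < size N)%N -> (forall x, D.[x] != 0) ->
  permutation_rational_function (N%:F / D%:F) ->
  forall s, exists x, N.[x] = s * D.[x].
Proof.
move=> ltDN Dx [e [g [h [[e0 mg mh cgh fE] bij_f]]]] s.
have D0 : D != 0 by apply: contraTneq (Dx 0) => ->; rewrite horner0 eqxx.
have h0 := monic_neq0 mh; have g0 := monic_neq0 mg.
have N0 : N != 0 by rewrite -size_poly_gt0 (leq_ltn_trans _ ltDN).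
have E : N * h = e%:P * g * D.
  have DF : D%:F != 0 by rewrite tofrac_eq0.
  have hF : h%:F != 0 by rewrite tofrac_eq0.
  move/eqP: fE; rewrite mulrA (eqr_div _ _ DF hF) -!tofracM.
  by rewrite tofrac_eq => /eqP.
have ltgh : (size h < size g)%N.
  have := congr1 (fun P : {poly F} => size P) E.
  rewrite mul_polyC size_mul // size_mul ?scaler_eq0 ?negb_or ?e0 // size_scale //.
  move: h0 g0 D0 ltDN; rewrite -!size_poly_gt0.
  by move: (size N) (size D) (size g) (size h); lia.
have hx x : h.[x] != 0.
  apply/eqP => hx0; have := congr1 (fun P => P.[x]) E.
  rewrite !hornerE hx0 mulr0 => /esym/eqP.
  rewrite !mulf_eq0 (negPf e0) (negPf (Dx x)) orbF /= => gx0.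
  by have := coprimep_root cgh gx0; rewrite hx0 eqxx.
have [r _ fK] := bij_f; have := fK (Some s).
case: (r _) => [x|] /=; last by rewrite ltgh.
rewrite (negPf (hx x)) => -[sE]; exists x.
have := congr1 (fun P => P.[x]) E; rewrite !hornerE => Ex.
by apply: (mulIf (hx x)); rewrite Ex -sE; field; rewrite hx.
Qed.

(** The condition on [x1] and [x2] places them symmetrically about the vertex of
    the quadratic, whose values there coincide; on a finite set, a map covering
    the set would be injective. *)
Lemma quadratic_not_onto (F : finFieldType) (S : {set F}) (u v w x1 x2 : F) :
  x1 \in S -> x2 \in S -> x1 != x2 -> u * (x1 + x2) + v = 0 ->
  exists2 y, y \in S & forall x, x \in S -> u * x ^+ 2 + v * x + w != y.
Proof.
move=> Sx1 Sx2 /eqP x12 /eqP; rewrite addrC addr_eq0 => /eqP vE.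
pose Q x := u * x ^+ 2 + v * x + w.
have [sSQ|] := boolP (S \subset Q @: S); last first.
  case/subsetPn => y Sy yNQ; exists y => // x Sx.
  by apply: contraNneq yNQ => <-; apply: imset_f.
have /imset_injP injQ : #|Q @: S| == #|S|.
  by rewrite eqn_leq leq_imset_card subset_leq_card.
have /injQ-/(_ Sx1 Sx2) // : Q x1 = Q x2 by rewrite /Q vE; ring.
Qed.

(** The usual sum [y + J (beta * y)] works as soon as it is nonzero: take
    [y = 1], or [y = d] when beta = -1. *)
Lemma involution_hilbert90 (F : fieldType) (J : {rmorphism F -> F})
    (beta d : F) :
  involutive J -> J d != d -> beta * J beta = 1 ->
  exists2 alpha, alpha != 0 & J alpha = beta * alpha.
Proof.
move=> JK Jd betaN; have [betaE|betaN1] := eqVneq beta (-1).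
  exists (d - J d); first by rewrite subr_eq0 eq_sym.
  by rewrite rmorphB JK betaE; ring.
exists (1 + J beta).
  apply: contraNneq betaN1 => /(congr1 J).
  by rewrite rmorphD rmorph1 JK rmorph0 addrC => /eqP; rewrite addr_eq0.
by rewrite rmorphD rmorph1 JK mulrDr betaN mulr1 addrC.
Qed.

(** The elimination of x described at the top, for an arbitrary involution; the
    value missed is [(s0 - l0) / eps], where l0 is a fixed point of J that the
    quadratic Q misses. *)
Lemma involution_quotient_not_onto (F : finFieldType) (J : {rmorphism F -> F})
    (beta a b c d : F) :
  involutive J -> 2%:R != 0 :> F -> J d != d -> beta != 1 -> beta * J beta = 1 ->
  exists s, forall x,
    x * J x + beta * x ^+ 2 + a * J x + b * x + c != s * (J x + x + d).
Proof.
move=> JK two0 Jd beta1 betaN.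
have [alpha al0 Jal] := involution_hilbert90 _ _ _ _ JK Jd betaN.
have Jal0 : J alpha != 0 by rewrite fmorph_eq0.
pose eps := J alpha - alpha.
have eps0 : eps != 0.
  by rewrite /eps Jal -{2}[alpha]mul1r -mulrBl mulf_neq0 // subr_eq0.
pose L x := J alpha * x + alpha * J x.
pose s0 := a * J alpha - alpha * b.
pose B := alpha * (d + b - a).
pose C := alpha * (eps * c - d * s0).
pose P x := x ^+ 2 + B * x + C.
have numE x : alpha * eps * (x * J x + beta * x ^+ 2 + a * J x + b * x + c)
    = alpha * (s0 - L x) * (J x + x + d) + P (L x).
  by rewrite /P /L /C /B /s0 /eps Jal; ring.
have JL x : J (L x) = L x by rewrite /L rmorphD !rmorphM !JK; ring.
(* Only numE and the J-invariance of L matter from here on. *)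
clearbody B C L.
pose kap := (d - J d) * alpha * J alpha.
have kap0 : kap != 0 by rewrite !mulf_neq0 // subr_eq0 eq_sym.
pose B' := J alpha * B - alpha * J B.
pose C' := J alpha * C - alpha * J C.
(* The vertex of [l |-> l - (J alpha * P l - alpha * J (P l)) / kap]. *)
pose m := (kap - B') / eps / 2%:R.
have Jeps : J eps = - eps by rewrite /eps rmorphB JK opprB.
have JB' : J B' = - B' by rewrite /B' rmorphB !rmorphM !JK; ring.
have Jkap : J kap = - kap by rewrite /kap !rmorphM rmorphB !JK; ring.
have Jm : J m = m.
  rewrite /m 2!rmorphM rmorphB !fmorphV Jkap JB' Jeps rmorph_nat.
  by field; rewrite oppr_eq0 two0 eps0.
pose S := [set x | J x == x].
have S1 : m + 1 \in S by rewrite inE rmorphD Jm rmorph1.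
have S2 : m - 1 \in S by rewrite inE rmorphB Jm rmorph1.
have [||l0 Sl0 l0Q] := @quadratic_not_onto F S
    (- eps / kap) (1 - B' / kap) (- C' / kap) _ _ S1 S2.
- by rewrite -subr_eq0 (_ : _ - _ = 2%:R) //; ring.
- by rewrite /m; field; rewrite two0 eps0 kap0.
exists ((s0 - l0) / eps) => x; apply/eqP => xE.
have SL : L x \in S by rewrite inE JL.
have PE : P (L x) = alpha * (L x - l0) * (J x + x + d).
  apply/eqP; rewrite -subr_eq0; apply/eqP; have := numE x; rewrite xE => nE.
  transitivity (P (L x) - alpha * (L x - l0) * (J x + x + d) + 0); first by ring.
  by rewrite -(subrr (alpha * eps * ((s0 - l0) / eps * (J x + x + d))))
     {2}nE; field.
have JPE : L x ^+ 2 + J B * L x + J C = J alpha * (L x - l0) * (J x + x + J d).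
  have := congr1 J PE; rewrite /P !(rmorphD, rmorphM, rmorphXn, rmorphN) JL JK.
  rewrite (eqP (_ : J l0 == l0)); last by rewrite inE in Sl0.
  by move->; ring.
have /eqP[] := l0Q _ SL.
have key : eps * L x ^+ 2 + B' * L x + C' = kap * (L x - l0).
  transitivity (J alpha * P (L x) - alpha * (L x ^+ 2 + J B * L x + J C)).
    by rewrite /P /eps /B' /C'; ring.
  by rewrite PE JPE /kap; ring.
transitivity (L x - (eps * L x ^+ 2 + B' * L x + C') / kap).
  by field.
by rewrite key; field.
Qed.

(** A subfield K of size n consists of roots of [X^n - X], which has at most n
    roots.  That a nonzero x in K satisfies [x ^+ n.-1 = 1] is seen by comparing
    the product of all nonzero elements of K with its image under
    multiplication by x. *)
Lemma subfield_fixed (F : finFieldType) (K : {set F}) :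
  GRing.divring_closed K -> forall x, (x \in K) = (x ^+ #|K| == x).
Proof.
move=> [K1 KB Kdiv].
have K0 : 0 \in K by rewrite -(subrr 1) KB.
have KM x y : x \in K -> y \in K -> x * y \in K.
  by move=> Kx Ky; rewrite -[y]invrK -[y^-1]mul1r Kdiv // Kdiv.
have Kpos : (1 < #|K|)%N.
  by apply: leq_trans (subset_leq_card (_ : [set 0; 1] \subset K));
     rewrite ?cards2 1?eq_sym ?oner_eq0 // subUset !sub1set K0 K1.
have Kfix x : x \in K -> x ^+ #|K| = x.
  move=> Kx; have [->|x0] := eqVneq x 0; first by rewrite expr0n; case: #|K| Kpos.
  have K'x : [set x * y | y in K :\ 0] = K :\ 0.
    apply/eqP; rewrite eqEcard card_imset ?leqnn ?andbT; last exact: mulfI.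
    apply/subsetP => _ /imsetP[y /setD1P[y0 Ky] ->].
    by rewrite !inE mulf_neq0 ?KM.
  pose P := \prod_(y in K :\ 0) y.
  have P0 : P != 0 by apply/prodf_neq0 => y /setD1P[].
  have : P = x ^+ #|K :\ 0| * P.
    rewrite {1}/P -[in LHS]K'x big_imset /=; last by move=> ? ? _ _; apply: mulfI.
    by rewrite big_split /= prodr_const.
  rewrite -{1}[P]mul1r => /(mulIf P0) xE.
  by rewrite (cardsD1 0 K) K0 exprS -xE mulr1.
have sub : K \subset [set x | x ^+ #|K| == x].
  by apply/subsetP => x Kx; rewrite inE Kfix.
suff KE : K = [set x | x ^+ #|K| == x] by move=> x; rewrite {1}KE inE.
apply/eqP; rewrite eqEcard sub /= cardE.
pose P : {poly F} := 'X^#|K| - 'X.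
have sP : size P = #|K|.+1.
  by rewrite size_polyDl size_polyXn // size_polyN size_polyX.
rewrite -ltnS -sP; apply: max_poly_roots.
- by rewrite -size_poly_gt0 sP.
- by apply/allP => x; rewrite mem_enum inE /root !hornerE subr_eq0.
- exact: enum_uniq.
Qed.

Theorem proposition6 (p k q : nat) (p_prime : prime p) (k_gt0 : (0 < k)%N)
    (q_def : q = (p ^ k)%N) (q_odd : odd q)
    (F : finFieldType) (card_F : #|F| = (q ^ 2)%N)
    (Fq : {set F}) (Fq_subfield : GRing.divring_closed Fq) (card_Fq : #|Fq| = q)
    (beta a b c d : F) (d_notin_Fq : d \notin Fq)
    (beta_neq1 : beta != 1) (beta_norm : beta ^+ q.+1 = 1) :
  ~ permutation_rational_function
      (('X^(q.+1) + beta *: 'X^2 + a *: 'X^q + b *: 'X + c%:P)%:F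
         / ('X^q + 'X + d%:P)%:F).
Proof.
have p_gt1 := prime_gt1 p_prime.
have q_gt2 : (2 < q)%N.
  have : (1 < q)%N by rewrite q_def -(exp1n k) ltn_exp2r.
  by case: (q) q_odd => [|[|[]]].
have charF : p \in [pchar F].
  have cF : #|F| = (p ^ (k * 2))%N by rewrite card_F q_def expnM.
  exact: card_finPcharP cF p_prime.
have pnatq : [pchar F].-nat q.
  by rewrite q_def pnatX (pnatE _ p_prime) charF.
have two0 : 2%:R != 0 :> F.
  rewrite -(dvdn_pcharf charF); apply/negP => /dvdn_leq/=.
  have : odd p by move: q_odd; rewrite q_def oddX eqn0Ngt k_gt0.
  by case: (p) p_gt1 => [|[|[]]] // n _ _ /(_ isT).
pose J0 (x : F) := x ^+ q.
have J0B : zmod_morphism J0.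
  move=> x y; rewrite /J0 exprDn_pchar // -mulN1r exprMn -signr_odd q_odd expr1.
  by rewrite mulN1r.
have J0M : monoid_morphism J0 by split=> [|x y]; rewrite /J0 ?expr1n ?exprMn.
pose J : {rmorphism F -> F} := HB.pack J0
  (GRing.isZmodMorphism.Build F F J0 J0B) (GRing.isMonoidMorphism.Build F F J0 J0M).
have JE x : J x = x ^+ q by [].
have JK : involutive J.
  by move=> x; rewrite !JE -exprM mulnn -card_F expf_card.
have fixE x : (x \in Fq) = (J x == x).
  by rewrite (subfield_fixed _ _ Fq_subfield) card_Fq.
rewrite fixE in d_notin_Fq.
have betaN : beta * J beta = 1 by rewrite JE -exprS.
have sD : size ('X^q + 'X + d%:P) = q.+1.
  rewrite -addrA size_polyDl size_polyXn // size_XaddC.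
  by rewrite ltnS ltnW.
have [s sN] := involution_quotient_not_onto F J _ a b c _
  JK two0 d_notin_Fq beta_neq1 betaN.
move=> perm_f.
have [||x] := permutation_rational_function_onto _ _ _ _ _ perm_f s.
- rewrite sD ltnNge; apply/negP => leN.
  (* The coefficient of degree q + 1 of the numerator is 1. *)
  have := leq_sizeP _ _ leN q.+1 (leqnn _).
  rewrite !(coefD, coefZ, coefXn, coefX, coefC) eqxx.
  have -> : (q.+1 == 2%N) = false by lia.
  have -> : (q.+1 == q) = false by lia.
  have -> : (q.+1 == 1%N) = false by lia.
  by rewrite /= !mulr0 !addr0 => /eqP; rewrite oner_eq0.
(* A root of the denominator would give d = - (x + J x), fixed by J. *)
- move=> x; rewrite !hornerE -JE; apply: contraNneq d_notin_Fq => /eqP.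
  rewrite addrC addr_eq0 => /eqP->.
  by rewrite rmorphN rmorphD JK addrC.
rewrite !(hornerD, hornerZ, hornerXn, hornerX, hornerC) exprS -!JE.
exact/eqP/sN.
Qed.
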